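(* Let $k\ge 1$ be an integer and let $A\in\mathbb{Z}^{(m+1)\times(d+1)}$ be a matrix of rank $m+1$ whose first row is $(1,\dots,1)$. (i) The variety $X_{A^{(k)}}\subset\mathbb{P}^d$ is a $k$th toric interpolant of $X_A$ at all points in the torus of $X_A$, i.e., at all points of $X_A$ lying in the torus of $\mathbb{P}^d$ (all points of $X_A$ with all coordinates nonzero). (ii) Assume there exists a matrix $B\in\mathbb{Z}^{(m_B+1)\times(d+1)}$, of rank $m_B+1$ and with first row $(1,\dots,1)$, such that $X_B$ is a $k$th toric interpolant of $X_A$ at one point $\mathbf{p}^*=\iota_A(\mathbf{t}^* )$ in the torus of $X_A$. Then $X_B=X_{A^{(k)}}$.
   Context: $\mathbb{P}^d$ is complex projective $d$-space. For an integer matrix $C$ with $n+1$ rows and with columns $(1,\mathbf{c}_0),\dots,(1,\mathbf{c}_d)$, $\mathbf{c}_j\in\mathbb{Z}^n$, let $\iota_C:(\mathbb{C}^* )^n\to\mathbb{P}^d$, $\iota_C(\mathbf{t})=(\mathbf{t}^{\mathbf{c}_0}:\cdots:\mathbf{t}^{\mathbf{c}_d})$ with $\mathbf{t}^{\mathbf{c}_j}=\prod_i t_i^{c_{i,j}}$, and let $X_C\subset\mathbb{P}^d$ be the Zariski closure of the image of $\iota_C$. The image of $\iota_C$ is the torus of $X_C$, and equals the set of points of $X_C$ with all coordinates nonzero. Matrices $A^{(k)}$ and $\widetilde A^{(k)}$: let $A$ have columns $(1,\mathbf{a}_j)$, $\mathbf{a}_j=(a_{1,j},\dots,a_{m,j})$,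 $j=0,\dots,d$. The matrix $\widetilde A^{(k)}\in\mathbb{Z}^{\binom{m+k}{k}\times(d+1)}$ is obtained from $A$ by adding below it one row for each $\mathbf{i}=(i_1,\dots,i_m)\in\mathbb{Z}_{\ge0}^m$ with $2\le|\mathbf{i}|=i_1+\dots+i_m\le k$ (in lexicographic order), whose $j$th entry is $a_{1,j}^{i_1}\cdots a_{m,j}^{i_m}$. When all entries of $A$ are nonnegative, $A^{(k)}\in\mathbb{Z}^{\binom{m+k}{k}\times(d+1)}$ is obtained in the same way, with the $j$th entry of the row indexed by $\mathbf{i}$ being $\binom{a_{1,j}}{i_1}\cdots\binom{a_{m,j}}{i_m}$. The two matrices have the same row span and define the same projective toric variety $X_{A^{(k)}}=X_{\widetilde A^{(k)}}$; if $A$ has negative entries, $X_{A^{(k)}}$ is understood as $X_{\widetilde A^{(k)}}$. Osculating spaces: the $k$th osculating space to $X_A$ at $\iota_A(\mathbf{t})$ is $\mathbb{P}$ of the row span (in $\mathbb{C}^{d+1}$) of the matrix whose rows are the vectors of all Hasse partial derivatives of order $\le k$ (including order $0$), with respect to $t_1,\dots,t_m$, of $(\mathbf{t}^{\mathbf{a}_0},\dots,\mathbf{t}^{\mathbf{a}_d})$, evaluated at $\mathbf{t}$. The Hasse derivative $\partial^{\mathbf{i}}$ is $\frac{1}{i_1!\cdots i_m!}$ times the usual partial derivative. Toric interpolants: a projective toric variety $X_B\subset\mathbb{P}^d$ is a $k$th toric interpolant of $X_A$ at $\mathbf{p}\in X_A$ if $X_A\subset X_B$ and the embedded tangent space to $X_B$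 at $\mathbf{p}$ is equal to the $k$th osculating space to $X_A$ at $\mathbf{p}$. *)

(* Defs.v *)
From HB Require Import structures.
From mathcomp Require Import all_boot all_order all_algebra complex mpoly.
From mathcomp Require Import classical_sets reals topology normedtype derive.
Import Order.TTheory GRing.Theory Num.Theory.
Import numFieldNormedType.Exports.

Set Implicit Arguments.
Unset Strict Implicit.
Unset Printing Implicit Defensive.

Local Open Scope ring_scope.
Local Open Scope classical_set_scope.

Definition Cplx (R : realType) : numClosedFieldType := R[i]%C.

(* A point of P^d is given by any nonzero row vector of homogeneous
   coordinates, and a subset of P^d by the set of all the row vectors that
   represent its points (the punctured affine cone). *)

Definition vanishes_on (C : numClosedFieldType) (d : nat)
    (S : set 'rV[C]_d.+1) (F : {mpoly C[d.+1]}) : Prop :=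
  forall x : 'rV[C]_d.+1, S x -> F.@[x ord0] = 0.

Definition zariski_closure (C : numClosedFieldType) (d : nat)
    (S : set 'rV[C]_d.+1) : set 'rV[C]_d.+1 :=
  [set x : 'rV[C]_d.+1 | x != 0 /\
    forall (e : nat) (F : {mpoly C[d.+1]}),
      F \is e.-homog -> vanishes_on S F -> F.@[x ord0] = 0].

(* The linear subspace of C^(d+1) whose projectivization is the embedded
   tangent space at p. *)
Definition tangent_space (C : numClosedFieldType) (d : nat)
    (X : set 'rV[C]_d.+1) (p : 'rV[C]_d.+1) : set 'rV[C]_d.+1 :=
  [set v : 'rV[C]_d.+1 | forall (e : nat) (F : {mpoly C[d.+1]}),
      F \is e.-homog -> vanishes_on X F ->
      \sum_(j < d.+1) (mderiv j F).@[p ord0] * v ord0 j = 0].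

Definition in_torus (C : numClosedFieldType) (n : nat) (t : 'I_n -> C) : Prop :=
  forall i, t i != 0.

(* The row ord0 of M is the row of ones; it carries no exponent. *)
Definition lmonomial (C : numClosedFieldType) (n d : nat)
    (M : 'M[int]_(n.+1, d.+1)) (j : 'I_d.+1) (t : 'I_n -> C) : C :=
  \prod_(i < n) t i ^ M (lift ord0 i) j.

Definition iota_map (C : numClosedFieldType) (n d : nat)
    (M : 'M[int]_(n.+1, d.+1)) (t : 'I_n -> C) : 'rV[C]_d.+1 :=
  \row_j lmonomial M j t.

Definition represents (C : numClosedFieldType) (n d : nat)
    (M : 'M[int]_(n.+1, d.+1)) (t : 'I_n -> C) (p : 'rV[C]_d.+1) : Prop :=
  exists2 c : C, c != 0 & p = c *: iota_map M t.

Definition toric_variety (C : numClosedFieldType) (n d : nat)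
    (M : 'M[int]_(n.+1, d.+1)) : set 'rV[C]_d.+1 :=
  zariski_closure
    [set p : 'rV[C]_d.+1 | exists2 t : 'I_n -> C, in_torus t & represents M t p].

Arguments toric_variety C {n d} M.

Definition mi_weight (m k : nat) (i : m.-tuple 'I_k.+1) : nat :=
  (\sum_(l < m) tnth i l)%N.

Definition lexi_le (m k : nat) : rel (m.-tuple 'I_k.+1) :=
  fun i j => ((i : m.-tuplelexi 'I_k.+1) <= j)%O.

Definition low_indices (m k : nat) : seq (m.-tuple 'I_k.+1) :=
  sort (@lexi_le m k) [seq i <- enum {: m.-tuple 'I_k.+1} | (mi_weight i <= k)%N].

Definition high_indices (m k : nat) : seq (m.-tuple 'I_k.+1) :=
  [seq i <- low_indices m k | (2 <= mi_weight i)%N].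

Definition nhigh (m k : nat) : nat := size (high_indices m k).

(* The matrices below, with (m + nhigh m k).+1 rows, have the expected height
   when k > 0. *)
Lemma nhigh_rows (m k : nat) :
  (0 < k)%N -> (m + nhigh m k).+1 = 'C(m + k, k).
Proof.
move=> k_gt0; pose T : finType := m.-tuple 'I_k.+1.
pose w : T -> nat := @mi_weight m k.
have total : #|[pred i : T | (w i <= k)%N]| = 'C(m + k, k).
  rewrite -(bin_sub (leq_addl m k)) addnK -card_partial_ord_partitions cardsE.
  apply: eq_card => i; by rewrite !inE /w /mi_weight unfold_in -(big_tuple _ _ i xpredT (fun j : 'I_k.+1 => j : nat)).
have high : nhigh m k = #|[pred i : T | (2 <= w i <= k)%N]|.
  rewrite /nhigh /high_indices size_filter /low_indices.
  have /permP -> := permEl (perm_sort (@lexi_le m k)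
     [seq i <- enum T | (mi_weight i <= k)%N]).
  by rewrite count_filter cardE /enum_mem size_filter count_filter; apply: eq_count => i; rewrite !inE andbT.
pose u (o : option 'I_m) : T :=
  [tuple if o == Some l then inord 1 else ord0 | l < m].
have uE o l : (tnth (u o) l : nat) = (o == Some l).
  by rewrite tnth_mktuple; case: eqP; rewrite ?inordK // ltnS.
have u_inj : injective u.
  move=> o o' e; case: o e => [l|] e.
    have := uE (Some l) l; rewrite e uE eqxx.
    by case: eqP.
  case: o' e => [l|] // e; by have := uE (Some l) l; rewrite -e uE eqxx.
have low : #|[pred i : T | (w i <= 1)%N]| = m.+1.
  rewrite -[m.+1](_ : #|{: option 'I_m}| = _); last by rewrite card_option card_ord.
  rewrite -(card_codom u_inj); apply: eq_card => i; rewrite inE.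
  apply/idP/codomP => [|[o ->]].
    rewrite leq_eqVlt ltnS leqn0 => /orP[/eqP|] wi.
      have [l il] : exists l, tnth i l != 0 :> nat.
        apply/existsP; rewrite -[[exists _, _]]negbK; apply/negP => /existsPn z.
        by move: wi; rewrite /w /mi_weight big1 // => l _; apply/eqP/negPn/z.
      exists (Some l); apply/eq_from_tnth => j; apply/val_inj; rewrite /= uE.
      move: wi; rewrite /w /mi_weight (bigD1 l) //=.
      case en: (nat_of_ord (tnth i l)) il => [|n] // _.
      rewrite addSn => -[] /eqP; rewrite addn_eq0 => /andP[/eqP n0 /eqP s0].
      have [[<-]|/eqP jl] := (Some l =P Some j); first by rewrite en n0.
      have jl' : j != l by apply: contraNneq jl => ->.
      by move/eqP: s0; rewrite sum_nat_eq0 => /forallP/(_ j)/implyP/(_ jl')/eqP.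
    exists None; apply/eq_from_tnth => j; apply/val_inj; rewrite /= uE.
    by move: wi; rewrite /w /mi_weight sum_nat_eq0 => /forallP/(_ j)/eqP.
  rewrite /w /mi_weight (eq_bigr _ (fun l _ => uE o l)).
  case: o => [l|]; last by rewrite big1.
  rewrite (bigD1 l) //= eqxx big1 // => j /negPf; rewrite eq_sym => jl.
  by case: eqP => // -[e]; rewrite e eqxx in jl.
rewrite -addSn high -total -low.
rewrite -(cardID [pred i : T | (w i <= 1)%N] [pred i : T | (w i <= k)%N]).
congr (_ + _)%N; apply: eq_card => i; rewrite !inE //.
  by case: (leqP (w i) 1) => [wi|_]; rewrite ?(leq_trans wi k_gt0) ?andbF.
by rewrite ltnNge.
Qed.

Definition Apow (m d k : nat) (A : 'M[int]_(m.+1, d.+1)) :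
    'M[int]_((m + nhigh m k).+1, d.+1) :=
  col_mx A (\matrix_(r < nhigh m k, j < d.+1)
    \prod_(l < m) A (lift ord0 l) j ^+ tnth (tnth (in_tuple (high_indices m k)) r) l).

Definition Abin (m d k : nat) (A : 'M[int]_(m.+1, d.+1)) :
    'M[int]_((m + nhigh m k).+1, d.+1) :=
  col_mx A (\matrix_(r < nhigh m k, j < d.+1)
    \prod_(l < m) ('C(`|A (lift ord0 l) j|,
                      tnth (tnth (in_tuple (high_indices m k)) r) l))%:Z).

(* The matrix A^(k), with the convention that it is the matrix of powers as soon
   as A has a negative entry. *)
Definition Aosc (m d k : nat) (A : 'M[int]_(m.+1, d.+1)) :
    'M[int]_((m + nhigh m k).+1, d.+1) :=
  if [forall i, forall j, 0 <= A i j] then Abin k A else Apow k A.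

(* Complex partial derivative: [derive1] is taken over the field C. *)
Definition partial (C : numClosedFieldType) (m : nat) (l : 'I_m)
    (f : ('I_m -> C) -> C) : ('I_m -> C) -> C :=
  fun t => derive1 (fun z : C => f [eta t with l |-> z]) (t l).

Definition hasse (C : numClosedFieldType) (m k : nat) (i : m.-tuple 'I_k.+1)
    (f : ('I_m -> C) -> C) : ('I_m -> C) -> C :=
  fun t => (\prod_(l < m) ((tnth i l)`!)%:R)^-1 *
    foldr (fun l g => iter (tnth i l) (partial l) g) f (enum 'I_m) t.

Definition osc_matrix (C : numClosedFieldType) (m d k : nat)
    (A : 'M[int]_(m.+1, d.+1)) (t : 'I_m -> C) :
    'M[C]_(size (low_indices m k), d.+1) :=
  \matrix_(r, j)
    hasse (tnth (in_tuple (low_indices m k)) r) (lmonomial A j) t.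

(* The linear subspace of C^(d+1) whose projectivization is the k-th osculating
   space at a point p of the torus.  The row span is the same for every
   parameter t of p. *)
Definition osculating_space (C : numClosedFieldType) (m d k : nat)
    (A : 'M[int]_(m.+1, d.+1)) (p : 'rV[C]_d.+1) : set 'rV[C]_d.+1 :=
  [set v : 'rV[C]_d.+1 | exists2 t : 'I_m -> C, in_torus t /\ represents A t p &
             (v <= osc_matrix k A t)%MS].

Definition toric_interpolant (C : numClosedFieldType) (m n d k : nat)
    (A : 'M[int]_(m.+1, d.+1)) (B : 'M[int]_(n.+1, d.+1))
    (p : 'rV[C]_d.+1) : Prop :=
  [/\ toric_variety C A p,
      toric_variety C A `<=` toric_variety C B &
      tangent_space (toric_variety C B) p = osculating_space k A p].

Definition first_row_ones (n d : nat) (M : 'M[int]_(n.+1, d.+1)) : Prop :=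
  forall j, M ord0 j = 1.

Definition int_rank (n d : nat) (M : 'M[int]_(n, d)) : nat :=
  \rank (map_mx intr M : 'M[rat]_(n, d)).

(* Main.v *)
Require Import Defs.
From HB Require Import structures.
From mathcomp Require Import all_boot all_order all_algebra complex mpoly.
From mathcomp Require Import classical_sets reals topology normedtype derive.
Import Order.TTheory GRing.Theory Num.Theory.
Import numFieldNormedType.Exports.
Set Implicit Arguments.
Unset Strict Implicit.
Unset Printing Implicit Defensive.

Local Open Scope ring_scope.
Local Open Scope classical_set_scope.

(* On the torus everything is linear in the logarithmic coordinates v_j / p_j.
   The torus of X_M is cut out by the binomial equations x^u = 1, u in the
   integer kernel of M.  Differentiating these binomials on one side and the
   one-parameter subgroups z |-> (p_j z^(b_j)), b in the row span of M, on the
   other shows that the tangent space of X_M at a torus point p is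
   rowspan(M) diag(p).  The Hasse derivatives of t^a are the products of the
   generalized binomials binom(a_l, i_l) times t^(a-i), so the k-th osculating
   space of X_A at p is rowspan(A^(k)) diag(p).  This gives (i); for (ii), B and
   A^(k) have the same row span, hence the same integer kernel, hence the same
   torus. *)

(** * Osculating spaces *)

(** The factors are formed in the ring, so negative exponents are allowed. *)
Definition falling (K : pzRingType) (a : K) (n : nat) : K :=
  \prod_(s < n) (a - s%:R).

Lemma fallingS (K : pzRingType) (a : K) (n : nat) :
  falling a n.+1 = falling a n * (a - n%:R).
Proof. exact: big_ord_recr. Qed.

Lemma is_derive_exprz (K : numFieldType) (n : int) (z : K) :
  z != 0 -> is_derive z (1 : K) (fun x : K => x ^ n) (n%:~R * z ^ (n - 1)).
Proof.
move=> z0; case: n => n.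
  apply: DeriveDef; first exact: exprn_derivable.
  rewrite exp_derive -[LHS]/(n%:R * z ^+ n.-1 * 1) mulr1.
  (* For exponent 0 the truncated predecessor is 0 instead of -1, but the coefficient vanishes. *)
  case: n => [|n]; first by rewrite mulr0z !mul0r.
  by rewrite -[X in _ = _ * _ ^ X]/(n.+1%:Z - 1%:Z) subzSS subr0.
have dz : derivable (@GRing.exp K ^~ n.+1) z 1 by exact: exprn_derivable.
have zn0 : z ^+ n.+1 != 0 by rewrite expf_neq0.
apply: DeriveDef; first exact: derivableV.
rewrite deriveV // exp_derive NegzE.
rewrite -[LHS]/(- (z ^+ n.+1) ^- 2 * (n.+1%:R * (z ^+ n) * 1)).
rewrite mulr1 mulrNz.
have -> : (- n.+1%:Z - 1)%R = - (n.+2)%:Z by rewrite -opprD -PoszD addn1.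
rewrite -exprz_inv -[in RHS]exprnP !exprVn.
rewrite !mulNr mulrCA; congr (- (_ * _)).
rewrite -exprM muln2 -addnn addSnnS exprD invfM mulrC mulrA mulfV ?mul1r //.
by rewrite expf_neq0.
Qed.

(** The function is known on the torus only, because that is all an earlier derivation provides.
    This suffices: a nonzero [t l] stays nonzero under small changes, so the derivative only sees
    the torus. *)
Lemma partial_monomial (C : numClosedFieldType) (m : nat) (l : 'I_m)
    (f : ('I_m -> C) -> C) (c : C) (e : 'I_m -> int) (t : 'I_m -> C) :
  (forall u, in_torus u -> f u = c * \prod_i u i ^ e i) -> in_torus t ->
  partial l f t =
    c * (e l)%:~R * \prod_i t i ^ (e i - (if i == l then 1 else 0)).
Proof.
move=> fE tT; rewrite /partial derive1E.
have tl0 : t l != 0 := tT l.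
set r := \prod_(i | i != l) t i ^ e i.
rewrite (@near_eq_derive _ _ _ _ (fun z : C => c * r * z ^ e l)); last first.
  near=> z; rewrite fE => [|i /=].
    rewrite (bigD1 l) //= eqxx mulrA [RHS]mulrAC; congr (_ * _).
    by apply: eq_bigr => i /negPf ->.
  by case: ifP => // _; near: z; apply: (cvgr_neq0 (t l)).
have [D V] := is_derive_exprz (e l) tl0.
rewrite deriveMl // V (bigD1 l) //= eqxx -!mulrA; congr (_ * _).
rewrite mulrCA; congr (_ * _); rewrite mulrC; congr (_ * _).
by apply: eq_bigr => i /negPf ->; rewrite subr0.
Unshelve. all: by end_near.
Qed.

Lemma iter_partial_monomial (C : numClosedFieldType) (m : nat) (l : 'I_m)
    (n : nat) (f : ('I_m -> C) -> C) (c : C) (e : 'I_m -> int) (t : 'I_m -> C) :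
  (forall u, in_torus u -> f u = c * \prod_i u i ^ e i) -> in_torus t ->
  iter n (partial l) f t =
    c * falling (e l)%:~R n * \prod_i t i ^ (e i - (if i == l then n else 0%N)%:Z).
Proof.
move=> fE; elim: n t => [|n IHn] t tT /=.
  rewrite fE // /falling big_ord0 mulr1; congr (_ * _).
  by apply: eq_bigr => i _; case: ifP; rewrite subr0.
rewrite (partial_monomial _ IHn tT) eqxx fallingS mulrA; congr (_ * _ * _).
  by rewrite rmorphB.
apply: eq_bigr => i _; rewrite -addrA -opprD; congr (_ ^ (_ - _)).
by case: eqP => _; rewrite // -PoszD addn1.
Qed.

(** Since [s] has no repetition, the exponent of each variable is still the original [e l] when its
    own derivations are applied, so every falling factorial starts from [e l]. *)
Lemma foldr_partial_monomial (C : numClosedFieldType) (m : nat) (s : seq 'I_m)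
    (n : 'I_m -> nat) (f : ('I_m -> C) -> C) (e : 'I_m -> int) (t : 'I_m -> C) :
  (forall u, in_torus u -> f u = \prod_i u i ^ e i) -> in_torus t -> uniq s ->
  foldr (fun l g => iter (n l) (partial l) g) f s t =
    \prod_(l <- s) falling (e l)%:~R (n l) *
    \prod_i t i ^ (e i - (if i \in s then n i else 0%N)%:Z).
Proof.
move=> fE; elim: s t => [|l s IHs] t tT /=.
  by rewrite big_nil mul1r fE // => _; apply: eq_bigr => i _; rewrite subr0.
case/andP=> ls us; rewrite (iter_partial_monomial _ _ (fun u uT => IHs u uT us) tT).
rewrite (negPf ls) subr0 big_cons [X in X * _ = _]mulrC; congr (_ * _).
apply: eq_bigr => i _; rewrite inE; case: eqP => [->|_] /=.
  by rewrite (negPf ls) subr0.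
by rewrite subr0.
Qed.

Definition gbin (K : unitRingType) (n : nat) (a : K) : K :=
  falling a n / n`!%:R.

Lemma hasse_lmonomial (C : numClosedFieldType) (m d k : nat)
    (A : 'M[int]_(m.+1, d.+1)) (i : m.-tuple 'I_k.+1) (j : 'I_d.+1)
    (t : 'I_m -> C) :
  in_torus t ->
  hasse i (lmonomial A j) t =
    (\prod_l t l ^+ tnth i l)^-1 * \prod_l gbin (tnth i l) (A (lift ord0 l) j)%:~R
    * lmonomial A j t.
Proof.
move=> tT; rewrite /hasse.
rewrite (@foldr_partial_monomial _ _ _ (fun l => tnth i l : nat) _
  (fun l => A (lift ord0 l) j)) ?enum_uniq //.
rewrite big_enum /= -!prodfV -!big_split /=; apply: eq_bigr => l _.
rewrite mem_enum inE /= expfzDr ?tT // /gbin -invr_expz !mulrA.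
rewrite [LHS]mulrC !mulrA; congr (_ * _); exact: mulrAC.
Qed.

(** * Change of basis between powers and binomial coefficients *)

(** The bound [s <= n] is what keeps multi-indices of order at most [k] within that order after a
    change of family. *)
Definition triangular (K : pzRingType) (phi psi : nat -> K -> K) : Prop :=
  forall n, exists c : nat -> K,
    forall a, phi n a = \sum_(s < n.+1) c s * psi s a.

(** The falling factorial is a polynomial of degree [n] in [a]; its coefficients, divided by n!, are
    the required ones. *)
Lemma triangular_gbin_exp (K : fieldType) :
  triangular (@gbin K) (fun n a => a ^+ n).
Proof.
move=> n; pose p : {poly K} := \prod_(s < n) ('X - s%:R%:P).
exists (fun s => p`_s / n`!%:R) => a.
have -> : gbin n a = p.[a] / n`!%:R.
  rewrite /gbin horner_prod; congr (_ / _).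
  by apply: eq_bigr => s _; rewrite hornerXsubC.
rewrite horner_coef size_prod_XsubC /index_enum -enumT size_enum_ord mulr_suml.
by apply: eq_bigr => s _; rewrite mulrAC.
Qed.

Lemma triangular_exp_gbin (K : numFieldType) :
  triangular (fun n a => a ^+ n) (@gbin K).
Proof.
move=> n; suff [c cE] : exists c : nat -> K,
    forall a, a ^+ n = \sum_(s < n.+1) c s * falling a s.
  exists (fun s => c s * s`!%:R) => a; rewrite cE; apply: eq_bigr => s _.
  by rewrite /gbin -mulrA [_%:R * _]mulrC divfK // pnatr_eq0 -lt0n fact_gt0.
elim: n => [|n [c cE]].
  by exists (fun=> 1) => a; rewrite big_ord1 mul1r /falling big_ord0.
(* The recursion of the Stirling numbers of the second kind, from a * falling a s = falling a (s+1)
   + s * falling a s. The guard discards [c n.+1], about which nothing is known. *)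
exists (fun s => (if s is s'.+1 then c s' else 0) +
                 (if (s <= n)%N then s%:R * c s else 0)) => a.
transitivity (\sum_(s < n.+1) (c s * falling a s.+1 + s%:R * c s * falling a s)).
  rewrite exprSr cE mulr_suml; apply: eq_bigr => s _.
  by rewrite fallingS [s%:R * _]mulrC -!mulrA -!mulrDr [s%:R * _]mulrC -mulrDr subrK.
under [RHS]eq_bigr do rewrite mulrDl.
rewrite !big_split /=; congr (_ + _).
  by rewrite [RHS]big_ord_recl mul0r add0r; apply: eq_bigr.
rewrite [RHS]big_ord_recr /= ltnn mul0r addr0; apply: eq_bigr => s _.
by rewrite -ltnS ltn_ord.
Qed.

(** * Rows indexed by multi-indices and the span of A^(k) *)

Definition mirow (K : fieldType) (m d : nat) (phi : nat -> K -> K)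
    (A : 'M[int]_(m.+1, d)) (i : 'I_m -> nat) : 'rV[K]_d :=
  \row_j \prod_l phi (i l) (A (lift ord0 l) j)%:~R.

(** Expanding the product of the one-variable relations gives a combination of rows whose
    multi-indices are bounded entrywise by [i], hence still of order at most [k]. *)
Lemma mirow_triangular (K : fieldType) (m d k q : nat)
    (phi psi : nat -> K -> K) (A : 'M[int]_(m.+1, d)) (S : 'M[K]_(q, d)) :
  triangular phi psi ->
  (forall i : 'I_m -> nat, (\sum_l i l <= k)%N -> (mirow psi A i <= S)%MS) ->
  (forall i : 'I_m -> nat, (\sum_l i l <= k)%N -> (mirow phi A i <= S)%MS).
Proof.
move=> tri sub i ik.
have ilk l : (i l < k.+1)%N.
  by rewrite ltnS (leq_trans _ ik) // (bigD1 l) //= leq_addr.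
have [c cE] := fin_all_exists (fun l => tri (i l)).
(* Extension by zero gives all the sums the common range [k.+1], as distributing the product over
   them requires. *)
pose c' l s := if (s <= i l)%N then c l s else 0.
have -> : mirow phi A i =
    \sum_(f : {ffun 'I_m -> 'I_k.+1}) (\prod_l c' l (f l)) *: mirow psi A (fun l => f l).
  apply/rowP => j; rewrite !mxE summxE.
  transitivity (\prod_l \sum_(s < k.+1) c' l s * psi s (A (lift ord0 l) j)%:~R).
    apply: eq_bigr => l _; rewrite cE.
    rewrite (big_ord_widen _ (fun s => c l s * psi s _) (ilk l)) big_mkcond /=.
    by apply: eq_bigr => s _; rewrite /c' ltnS; case: ifP; rewrite ?mul0r.
  rewrite bigA_distr_bigA /=; apply: eq_bigr => f _.
  by rewrite !mxE -big_split.
apply: summx_sub => f _.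
have [fi|/forallPn[l fil]] := boolP [forall l, f l <= i l]%N; last first.
  by rewrite (bigD1 l) //= /c' (negPf fil) mul0r scale0r sub0mx.
apply/scalemx_sub/sub; apply: leq_trans ik; apply: leq_sum => l _.
exact: (forallP fi).
Qed.

Lemma mem_low_indices (m k : nat) (i : m.-tuple 'I_k.+1) :
  (i \in low_indices m k) = (mi_weight i <= k)%N.
Proof. by rewrite mem_sort mem_filter mem_enum andbT. Qed.

Lemma mem_high_indices (m k : nat) (i : m.-tuple 'I_k.+1) :
  (i \in high_indices m k) = (2 <= mi_weight i <= k)%N.
Proof. by rewrite mem_filter mem_low_indices. Qed.

Lemma tuple_of_multi_index (m k : nat) (i : 'I_m -> nat) :
  (\sum_l i l <= k)%N ->
  exists2 u : m.-tuple 'I_k.+1,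
    mi_weight u = \sum_l i l & forall l, tnth u l = i l :> nat.
Proof.
move=> ik; have uE l : tnth [tuple inord (i l) : 'I_k.+1 | l < m] l = i l :> nat.
  by rewrite tnth_mktuple inordK // ltnS (leq_trans _ ik) // (bigD1 l) //= leq_addr.
by exists [tuple inord (i l) : 'I_k.+1 | l < m]; first exact: eq_bigr.
Qed.

Lemma eq_mirow (K : fieldType) (m d : nat) (phi psi : nat -> K -> K)
    (A : 'M[int]_(m.+1, d)) (i i' : 'I_m -> nat) :
  (forall n l j, phi n (A (lift ord0 l) j)%:~R = psi n (A (lift ord0 l) j)%:~R) ->
  i =1 i' -> mirow phi A i = mirow psi A i'.
Proof.
move=> e ei; apply/rowP => j; rewrite !mxE.
by apply: eq_bigr => l _; rewrite e ei.
Qed.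

Definition mirow_ext (K : fieldType) (m d k : nat) (psi : nat -> K -> K)
    (A : 'M[int]_(m.+1, d)) : 'M[K]_(m.+1 + nhigh m k, d) :=
  col_mx (map_mx intr A)
    (\matrix_(r < nhigh m k)
       mirow psi A (fun l => tnth (tnth (in_tuple (high_indices m k)) r) l)).

(** The rows of [A] itself account for the orders 0 and 1: order 0 gives the row of ones, and order
    1 the remaining rows. The appended block holds the orders from 2 to [k]. *)
Lemma mirow_ext_subP (K : fieldType) (m d k q : nat) (psi : nat -> K -> K)
    (A : 'M[int]_(m.+1, d.+1)) (S : 'M[K]_(q, d.+1)) :
  (0 < k)%N -> first_row_ones A ->
  (forall a, psi 0%N a = 1) -> (forall a, psi 1%N a = a) ->
  (mirow_ext k psi A <= S)%MS <->
  (forall i : 'I_m -> nat, (\sum_l i l <= k)%N -> (mirow psi A i <= S)%MS).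
Proof.
move=> k0 A1 psi0 psi1.
have row0 i : (forall l, i l = 0%N) -> mirow psi A i = row ord0 (map_mx intr A).
  move=> i0; apply/rowP => j; rewrite !mxE A1 big1 // => l _.
  by rewrite i0 psi0.
have row1 (i : 'I_m -> nat) (l : 'I_m) : (forall l', i l' = (l' == l) :> nat) ->
    mirow psi A i = row (lift ord0 l) (map_mx intr A).
  move=> il; apply/rowP => j; rewrite !mxE (bigD1 l) //= il eqxx psi1.
  by rewrite big1 ?mulr1 // => l' /negPf l'l; rewrite il l'l psi0.
rewrite /mirow_ext col_mx_sub; split=> [/andP[subA subH] i ik|sub]; last first.
  apply/andP; split; apply/row_subP => r.
    have [l ->|->] := unliftP ord0 r.
      rewrite -(row1 (fun l' => (l' == l) : nat)) //; apply: sub.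
      by rewrite (bigD1 l) //= eqxx big1 => [|l' /negPf ->].
    by rewrite -(row0 (fun=> 0)%N) //; apply: sub; rewrite big1.
  rewrite rowK; apply: sub.
  have := mem_tnth r (in_tuple (high_indices m k)).
  by rewrite mem_high_indices => /andP[].
have [wi|] := leqP 2 (\sum_l i l).
  have [u uw uE] := tuple_of_multi_index ik.
  have : u \in in_tuple (high_indices m k) by rewrite mem_high_indices uw wi.
  case/tnthP => r ur.
  rewrite (@eq_mirow _ _ _ _ psi _ _ (fun l => tnth u l)) // ur.
  by apply: submx_trans (submx_trans (row_sub r _) subH); rewrite rowK.
rewrite ltnS leq_eqVlt ltnS leqn0 => /orP[|/eqP/eqP].
  case/sum_nat_eq1 => l [_ il i0]; rewrite (row1 i l).
    by apply: submx_trans subA; exact: row_sub.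
  by move=> l'; case: eqP => [->|/eqP]; [rewrite il|move/i0->].
rewrite sum_nat_eq0 => /forallP i0; rewrite row0 => [|l].
  by apply: submx_trans subA; exact: row_sub.
exact/eqP/i0.
Qed.

Lemma gbin0 (K : fieldType) (a : K) : gbin 0%N a = 1.
Proof. by rewrite /gbin /falling big_ord0 fact0 divr1. Qed.

Lemma gbin1 (K : fieldType) (a : K) : gbin 1%N a = a.
Proof. by rewrite /gbin /falling big_ord1 subr0 divr1. Qed.

Lemma gbin_bin (K : numFieldType) (n : nat) (a : int) :
  0 <= a -> gbin n (a%:~R : K) = ('C(`|a|, n))%:R.
Proof.
case: a => // a _; apply: (@mulIf _ n`!%:R).
  by rewrite pnatr_eq0 -lt0n fact_gt0.
rewrite /gbin divfK ?pnatr_eq0 -?lt0n ?fact_gt0 // -natrM bin_ffact absz_nat.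
elim: n => [|n IHn]; first by rewrite /falling big_ord0 ffactn0.
rewrite fallingS IHn ffactnSr natrM.
(* For n > a the subtraction a - n truncates, but the falling factorial of [a] has already reached
   zero. *)
have [na|an] := leqP n a; first by rewrite natrB.
by rewrite ffact_small ?mul0r.
Qed.

(** Describing the row span by the spaces [S] that contain it treats both conventions for A^(k) at
    once: powers and binomials are triangular in each other, so their rows span the same space. *)
Lemma map_Aosc_subP (K : numFieldType) (m d k q : nat)
    (A : 'M[int]_(m.+1, d.+1)) (S : 'M[K]_(q, d.+1)) :
  (0 < k)%N -> first_row_ones A ->
  (map_mx intr (Aosc k A) <= S)%MS <->
  (forall i : 'I_m -> nat,
     (\sum_l i l <= k)%N -> (mirow (@gbin K) A i <= S)%MS).
Proof.
move=> k0 A1; rewrite /Aosc; case: ifP => [/forallP A0|_].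
  have <- : mirow_ext k (@gbin K) A = map_mx intr (Abin k A).
    apply: etrans (esym (map_col_mx intr _ _)); congr col_mx; apply/matrixP => r j.
    rewrite !mxE rmorph_prod; apply: eq_bigr => l _.
    by have /forallP/(_ j)/gbin_bin-> := A0 (lift ord0 l).
  by apply: mirow_ext_subP => // a; rewrite ?gbin0 ?gbin1.
have <- : mirow_ext k (fun n (a : K) => a ^+ n) A = map_mx intr (Apow k A).
  apply: etrans (esym (map_col_mx intr _ _)); congr col_mx; apply/matrixP => r j.
  by rewrite !mxE rmorph_prod; apply: eq_bigr => l _; rewrite rmorphXn.
rewrite mirow_ext_subP //; split; apply: mirow_triangular.
  exact: triangular_gbin_exp.
exact: triangular_exp_gbin.
Qed.

(** The Hasse row of index i is the binomial row of index i, scaled columnwise by the point and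
    multiplied by the nonzero scalar t^(-i). *)
Lemma osc_matrix_eqmx (C : numClosedFieldType) (m d k : nat)
    (A : 'M[int]_(m.+1, d.+1)) (t : 'I_m -> C) :
  (0 < k)%N -> first_row_ones A -> in_torus t ->
  (osc_matrix k A t :=: map_mx intr (Aosc k A) *m diag_mx (iota_map A t))%MS.
Proof.
move=> k0 A1 tT; set S := map_mx _ _; set D := diag_mx _.
have subS : (S <= S)%MS by [].
move/(map_Aosc_subP _ k0 A1): subS => subS.
pose low := in_tuple (low_indices m k).
have rowE r : row r (osc_matrix k A t) = (\prod_l t l ^+ tnth (tnth low r) l)^-1 *:
    (mirow (@gbin C) A (fun l => tnth (tnth low r) l) *m D).
  by apply/rowP => j; rewrite /D mul_mx_diag 2![LHS]mxE hasse_lmonomial // !mxE mulrA.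
apply/eqmxP/andP; split.
  apply/row_subP => r; rewrite rowE; apply/scalemx_sub/submxMr/subS.
  by have := mem_tnth r low; rewrite mem_low_indices.
(* [Q] collects the binomial rows without the scalars t^(-i), which are divided out at the end. *)
pose Q := \matrix_(r < size (low_indices m k))
  mirow (@gbin C) A (fun l => tnth (tnth low r) l).
have subQ : (S <= Q)%MS.
  apply/map_Aosc_subP => // i ik; have [u uw uE] := tuple_of_multi_index ik.
  have : u \in low by rewrite mem_low_indices uw.
  case/tnthP => r ur.
  rewrite (@eq_mirow _ _ _ _ (@gbin C) _ _ (fun l => tnth u l)) // ur.
  by apply: submx_trans (row_sub r _); rewrite rowK.
apply: submx_trans (submxMr D subQ) _; apply/row_subP => r.
rewrite row_mul rowK; have := rowE r.
set c := (\prod_l _)^-1 => e.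
have c0 : c != 0 by rewrite invr_eq0; apply/prodf_neq0 => l _; rewrite expf_neq0 ?tT.
by rewrite -[X in (X <= _)%MS](scalerK c0) -e scalemx_sub ?row_sub.
Qed.

(** * The torus of a toric variety *)

(** Unlike in [lmonomial], every row carries an exponent. The row of ones then turns the scaling of
    homogeneous coordinates into one more torus parameter, and monomial maps compose as matrices
    multiply. *)
Definition tpow (C : fieldType) (n d : nat) (s : 'I_n -> C)
    (M : 'M[int]_(n, d)) (j : 'I_d) : C :=
  \prod_i s i ^ M i j.

Lemma prodr_exprz (C : fieldType) (I : Type) (r : seq I) (P : pred I)
    (F : I -> C) (a : int) :
  (\prod_(i <- r | P i) F i) ^ a = \prod_(i <- r | P i) F i ^ a.
Proof.
apply: (big_morph (fun x : C => x ^ a)) => [x y|]; last exact: exp1rz.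
exact: expfzMl.
Qed.

Lemma exprz_sum (C : fieldType) (I : Type) (r : seq I) (P : pred I)
    (x : C) (F : I -> int) :
  x != 0 -> x ^ (\sum_(i <- r | P i) F i) = \prod_(i <- r | P i) x ^ F i.
Proof.
move=> x0; apply: (big_morph (fun a : int => x ^ a)) => [a b|]; last exact: expr0z.
exact: expfzDr.
Qed.

Lemma tpow_neq0 (C : fieldType) (n d : nat) (s : 'I_n -> C) (M : 'M[int]_(n, d))
    (j : 'I_d) :
  (forall i, s i != 0) -> tpow s M j != 0.
Proof. by move=> s0; apply/prodf_neq0 => i _; rewrite expfz_neq0. Qed.

Lemma tpow_mulmx (C : fieldType) (n d e : nat) (s : 'I_n -> C)
    (M : 'M[int]_(n, d)) (N : 'M[int]_(d, e)) (j : 'I_e) :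
  (forall i, s i != 0) -> tpow s (M *m N) j = tpow (tpow s M) N j.
Proof.
move=> s0; rewrite /tpow [RHS](eq_bigr _ (fun l _ => prodr_exprz _ _ _ _)).
rewrite exchange_big /=; apply: eq_bigr => i _; rewrite mxE exprz_sum //.
by apply: eq_bigr => l _; rewrite exprz_exp.
Qed.

Lemma eq_tpow (C : fieldType) (n d : nat) (s s' : 'I_n -> C) (M : 'M[int]_(n, d)) :
  s =1 s' -> tpow s M =1 tpow s' M.
Proof. by move=> e j; apply: eq_bigr => i _; rewrite e. Qed.

Lemma tpow0 (C : fieldType) (n d : nat) (s : 'I_n -> C) (j : 'I_d) :
  tpow s (0 : 'M[int]_(n, d)) j = 1.
Proof. by rewrite /tpow big1 // => i _; rewrite mxE. Qed.

Lemma tpow1 (C : fieldType) (n : nat) (s : 'I_n -> C) : tpow s 1%:M =1 s.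
Proof.
move=> j; rewrite /tpow (bigD1 j) //= mxE eqxx expr1z big1 ?mulr1 // => i ij.
by rewrite mxE (negPf ij).
Qed.

Lemma exprz_surj (C : numClosedFieldType) (a : int) (y : C) :
  a != 0 -> y != 0 -> exists2 z : C, z != 0 & z ^ a = y.
Proof.
move=> a0 y0; have n0 : (0 < `|a|)%N by rewrite absz_gt0.
set z := `|a|%N.-root y; have zE : z ^+ `|a| = y by rewrite rootCK.
have z0 : z != 0 by apply: contraNneq y0 => z0; rewrite -zE z0 expr0n gtn_eqF.
case: a {a0} n0 z zE z0 => n n0 z zE z0; first by exists z.
by exists z^-1; rewrite ?invr_eq0 // NegzE exprz_inv opprK.
Qed.

(* By the Smith normal form this reduces to a diagonal matrix, where it is the
   divisibility of C^*. *)
Lemma tpow_surj (C : numClosedFieldType) (n d : nat) (M : 'M[int]_(n, d))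
    (x : 'I_d -> C) :
  (forall j, x j != 0) ->
  (forall u : 'cV[int]_d, M *m u = 0 -> tpow x u ord0 = 1) ->
  exists2 s : 'I_n -> C, (forall i, s i != 0) & tpow s M =1 x.
Proof.
move=> x0 xM; have [L Lu [Q Qu [a _ ME]]] := int_Smith_normal_form M.
set D := \matrix_(i, j) _ in ME.
pose y := tpow x (invmx Q).
have y0 j : y j != 0 by exact: tpow_neq0.
(* If column j of [D] is zero, then Q^(-1) e_j lies in the kernel of [M], and y_j is x raised to
   this vector. *)
have y1 j : col j D = 0 -> y j = 1.
  move=> Dj; rewrite -(xM (invmx Q *m delta_mx j ord0)).
    rewrite tpow_mulmx // -[RHS]/(tpow y _ _) /tpow (bigD1 j) //= mxE !eqxx expr1z.
    by rewrite big1 ?mulr1 // => i ij; rewrite mxE (negPf ij).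
  by rewrite ME -!mulmxA mulKVmx // -colE Dj mulmx0.
have root (i : 'I_n) : exists w : C,
    w != 0 /\ forall j : 'I_d, i = j :> nat -> w ^ a`_i = y j.
  have [ai|ai] := eqVneq a`_i 0.
    exists 1; split=> [|j ij]; rewrite ?oner_eq0 // exp1rz y1 //.
    by apply/colP => l; rewrite !mxE; case: eqP => // li; rewrite li -ij ai.
  have [id|di] := ltnP i d; last first.
    exists 1; split=> [|j ij]; rewrite ?oner_eq0 //.
    by have := ltn_ord j; rewrite -ij ltnNge di.
  have [w w0 wE] := exprz_surj ai (y0 (Ordinal id)).
  by exists w; split=> // j ij; rewrite wE; congr y; apply: val_inj.
have [z /all_and2[z0 zE]] := fin_all_exists root.
have zD : tpow z D =1 y.
  move=> j; have [jn|nj] := ltnP j n.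
    rewrite /tpow (bigD1 (Ordinal jn)) //= mxE eqxx mulr1n (zE _ j) //.
    by rewrite big1 ?mulr1 // => i; rewrite mxE -val_eqE => /= /negPf->.
  (* A column of [D] beyond its [n] rows has no diagonal entry, so it is zero. *)
  rewrite y1; last first.
    by apply/colP => l; rewrite !mxE ltn_eqF // (leq_trans (ltn_ord l)).
  by rewrite /tpow big1 // => i _; rewrite mxE ltn_eqF // (leq_trans (ltn_ord i)).
exists (tpow z (invmx L)) => [i|j]; first exact: tpow_neq0.
rewrite ME -tpow_mulmx // -mulmxA mulKmx // tpow_mulmx //.
by rewrite (eq_tpow _ zD) -tpow_mulmx // mulVmx // tpow1.
Qed.

(** This depends on [M] only through its integer kernel, which is how different matrices are
    compared. *)
Definition torus_of (C : fieldType) (n d : nat) (M : 'M[int]_(n, d)) : set 'rV[C]_d :=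
  [set x | (forall j, x ord0 j != 0) /\
           forall u : 'cV[int]_d, M *m u = 0 -> tpow (x ord0) u ord0 = 1].

Arguments torus_of C {n d} M.

(** The scalar [c] of a representative becomes the parameter of the row of ones; conversely
    [tpow_surj] solves for all the parameters, the first of which is that scalar. *)
Lemma torus_ofE (C : numClosedFieldType) (n d : nat) (M : 'M[int]_(n.+1, d.+1)) :
  first_row_ones M ->
  [set p : 'rV[C]_d.+1 | exists2 t : 'I_n -> C, in_torus t & represents M t p]
    = torus_of C M.
Proof.
move=> M1; apply/seteqP; split=> x /=.
  case=> t tT [c c0 xE].
  pose s (i : 'I_n.+1) := if unlift ord0 i is Some l then t l else c.
  have s0 i : s i != 0 by rewrite /s; case: unliftP => *; rewrite ?tT.
  have sE : x ord0 =1 tpow s M.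
    move=> j; rewrite xE !mxE /tpow big_ord_recl /s unlift_none M1 expr1z.
    by congr (_ * _); apply: eq_bigr => i _; rewrite liftK.
  split=> [j|u Mu]; first by rewrite sE tpow_neq0.
  by rewrite (eq_tpow _ sE) -tpow_mulmx // Mu tpow0.
case=> x0 /(tpow_surj x0)[s s0 sE].
exists (fun i => s (lift ord0 i)); first by move=> i.
exists (s ord0) => //; apply/rowP => j.
by rewrite !mxE -sE /tpow big_ord_recl M1 expr1z.
Qed.

Lemma sub_torus_of (C : fieldType) (n n' d : nat) (M : 'M[int]_(n, d))
    (M' : 'M[int]_(n', d)) :
  (forall u : 'cV[int]_d, M' *m u = 0 -> M *m u = 0) ->
  torus_of C M `<=` torus_of C M'.
Proof. by move=> sub x [x0 xM]; split=> // u /sub/xM. Qed.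

Lemma zariski_closureS (C : numClosedFieldType) (d : nat) (S T : set 'rV[C]_d.+1) :
  S `<=` T -> zariski_closure S `<=` zariski_closure T.
Proof.
by move=> ST x [x0 xS]; split=> // e F Fh FT; apply: (xS e) => // y /ST/FT.
Qed.

Lemma sub_zariski_closure (C : numClosedFieldType) (n d : nat)
    (M : 'M[int]_(n, d.+1)) :
  torus_of C M `<=` zariski_closure (torus_of C M).
Proof.
move=> x xM; split=> [|e F _]; last exact.
by apply: contraTneq (xM.1 ord0) => ->; rewrite mxE eqxx.
Qed.

(** * Tangent spaces *)

(** Exponents of polynomials are natural numbers, so u is split into positive and negative parts and
    x^u = 1 is replaced by the equality of two monomials. *)
Definition posm (d : nat) (u : 'cV[int]_d) : 'X_{1..d} :=
  [multinom (if (0 <= u j ord0)%R then `|u j ord0|%N else 0%N) | j < d].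

Definition binomial_of (C : nzRingType) (d : nat) (u : 'cV[int]_d) : {mpoly C[d]} :=
  'X_[posm u] - 'X_[posm (- u)].

Lemma posmB (d : nat) (u : 'cV[int]_d) (j : 'I_d) :
  (posm u j)%:Z - (posm (- u) j)%:Z = u j ord0.
Proof.
rewrite !mnmE mxE; case: (u j ord0) => [[|n]|n]; rewrite ?subr0 ?oppr0 //.
by rewrite NegzE opprK /= sub0r.
Qed.

(** The row of ones annihilates [u], so the entries of [u] sum to zero and both monomials have the
    same degree. *)
Lemma binomial_of_homog (C : nzRingType) (n d : nat) (M : 'M[int]_(n.+1, d.+1))
    (u : 'cV[int]_d.+1) :
  first_row_ones M -> M *m u = 0 -> binomial_of C u \is (mdeg (posm u)).-homog.
Proof.
move=> M1 Mu; have deg : mdeg (posm u) = mdeg (posm (- u)).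
  apply/eqP; rewrite -eqz_nat -subr_eq0 !mdegE -!natz !natr_sum -sumrB.
  have /matrixP/(_ ord0 ord0) := Mu; rewrite !mxE => e.
  rewrite -[X in _ == X]e; apply/eqP/eq_bigr => j _.
  by rewrite M1 mul1r -posmB !natz.
by rewrite /binomial_of rpredB // dhomogX // deg.
Qed.

Lemma meval_posm (C : fieldType) (d : nat) (u : 'cV[int]_d) (x : 'I_d -> C) :
  (forall j, x j != 0) ->
  'X_[posm u].@[x] = tpow x u ord0 * 'X_[posm (- u)].@[x].
Proof.
move=> x0; rewrite !mevalX /tpow -big_split /=; apply: eq_bigr => j _.
by rewrite -posmB !exprnP -expfzDr ?subrK.
Qed.

(** The factor [p j] turns the derivative into the operator x_j d/dx_j, which has monomials as
    eigenvectors. *)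
Lemma mderiv_monomial (C : comNzRingType) (d : nat) (m : 'X_{1..d}) (p : 'I_d -> C)
    (j : 'I_d) :
  (mderiv j 'X_[m]).@[p] * p j = (m j)%:R * 'X_[m].@[p].
Proof.
rewrite mderivX mevalZ -mulrA; case mj: (m j) => [|n]; first by rewrite !mul0r.
by rewrite -[p j]mevalXU -mevalM -mpolyXD submK // lep1mP mj.
Qed.

(** The homogeneous binomials of kernel vectors vanish on the closure; at a point with nonzero
    coordinates they may be divided by a monomial. *)
Lemma closure_torus_point (C : numClosedFieldType) (n d : nat)
    (M : 'M[int]_(n.+1, d.+1)) (x : 'rV[C]_d.+1) :
  first_row_ones M -> zariski_closure (torus_of C M) x ->
  (forall j, x ord0 j != 0) -> torus_of C M x.
Proof.
move=> M1 [_ xM] x0; split=> // u Mu.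
have nz : 'X_[posm (- u)].@[x ord0] != 0.
  by rewrite mevalX; apply/prodf_neq0 => j _; rewrite expf_neq0.
apply/(mulIf nz); rewrite mul1r -meval_posm //; apply/eqP.
rewrite -subr_eq0 -mevalB; apply/eqP/(xM _ _ (binomial_of_homog C M1 Mu)).
by move=> y [y0 yM]; rewrite mevalB meval_posm // yM // mul1r subrr.
Qed.

Lemma vanishes_on_closure (C : numClosedFieldType) (d e : nat)
    (S : set 'rV[C]_d.+1) (F : {mpoly C[d.+1]}) :
  F \is e.-homog -> vanishes_on S F -> vanishes_on (zariski_closure S) F.
Proof. by move=> Fe FS x [_ xS]; apply: (xS e). Qed.

Lemma poly_eq0_torus (K : numFieldType) (q : {poly K}) :
  (forall z, z != 0 -> q.[z] = 0) -> q = 0.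
Proof.
move=> q0; apply: (@roots_geq_poly_eq0 _ _ [seq i.+1%:R | i <- iota 0 (size q)]).
- by apply/allP => _ /mapP[i _ ->]; rewrite rootE q0 // pnatr_eq0.
- rewrite map_inj_uniq ?iota_uniq // => i j /eqP.
  by rewrite eqr_nat => /eqP[].
- by rewrite size_map size_iota.
Qed.

(* Differentiate [F (p_j z^(n_j))], a polynomial in [z], at [z = 1]. *)
Lemma deriv_one_parameter (K : numFieldType) (d : nat) (F : {mpoly K[d]})
    (p : 'I_d -> K) (n : 'I_d -> nat) :
  (forall z, z != 0 -> F.@[fun j => p j * z ^+ n j] = 0) ->
  \sum_j (mderiv j F).@[p] * (p j * (n j)%:R) = 0.
Proof.
move=> F0; pose q : {poly K} :=
  \sum_(m <- msupp F) (F@_m * 'X_[m].@[p]) *: 'X^(\sum_j n j * m j).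
have q0 : q = 0.
  apply: poly_eq0_torus => z z0; rewrite -(F0 z z0) mevalE horner_sum.
  apply: eq_bigr => m _; rewrite hornerZ hornerXn -mulrA; congr (_ * _).
  rewrite mevalX -prodrXr -big_split; apply: eq_bigr => j _ /=.
  by rewrite exprMn exprM.
have : (q^`()).[1] = 0 by rewrite q0 deriv0 horner0.
rewrite /q raddf_sum /= horner_sum => q1; rewrite -[RHS]q1.
transitivity (\sum_j \sum_(m <- msupp F) F@_m * ((m j)%:R * 'X_[m].@[p]) * (n j)%:R).
  apply: eq_bigr => j _; rewrite {1}[F]mpolyE (raddf_sum (mderiv j)).
  rewrite (raddf_sum (meval p)) mulr_suml.
  apply: eq_bigr => m _; rewrite /= mderivZ mevalZ [LHS]mulrA; congr (_ * _).
  by rewrite -mulrA mderiv_monomial.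
rewrite exchange_big /=; apply: eq_bigr => m _.
rewrite derivZ derivXn hornerZ hornerMn hornerXn expr1n natr_sum mulr_sumr.
apply: eq_bigr => j _; rewrite natrM -!mulrA; congr (_ * _).
by rewrite mulrC -mulrA.
Qed.

(** The kernel of [M] over [K] is spanned by rational vectors, the columns of a rational cokernel
    matrix; clearing denominators makes each of them an integer kernel vector. *)
Lemma int_kernel_dual (K : numFieldType) (n d : nat) (M : 'M[int]_(n, d))
    (w : 'rV[K]_d) :
  (forall u : 'cV[int]_d, M *m u = 0 -> w *m map_mx intr u = 0) ->
  (w <= map_mx intr M)%MS.
Proof.
move=> wM; pose MQ : 'M[rat]_(n, d) := map_mx intr M.
have -> : map_mx intr M = map_mx ratr MQ :> 'M[K]_(n, d).
  by apply/matrixP => i j; rewrite !mxE ratr_int.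
rewrite submxE -map_cokermx; apply/eqP/matrixP => i c; rewrite ord1 [RHS]mxE.
pose a j := cokermx MQ j c; pose D := \prod_j denq (a j).
have D0 : D != 0 by apply/prodf_neq0 => j _; exact: denq_neq0.
pose u : 'cV[int]_d := \col_j (numq (a j) * \prod_(l | l != j) denq (a l)).
have uE j : (u j ord0)%:~R = D%:~R * a j.
  rewrite mxE /D [in RHS](bigD1 j) //= !intrM numqE [a j * _]mulrC.
  exact: mulrAC.
have Mu : M *m u = 0.
  apply/matrixP => l c'; rewrite [c']ord1 [RHS]mxE; apply/eqP.
  rewrite -(intr_eq0 rat) mxE (rmorph_sum intr) /=; apply/eqP.
  transitivity (D%:~R * (MQ *m cokermx MQ) l c); last by rewrite mulmx_coker mxE mulr0.
  rewrite mxE mulr_sumr; apply: eq_bigr => j _.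
  by rewrite intrM uE mxE mulrCA.
have /matrixP/(_ ord0 ord0) := wM u Mu; rewrite mxE [RHS]mxE => wu.
apply: (@mulfI _ (D%:~R : K)); first by rewrite intr_eq0.
rewrite mulr0 mxE -[RHS]wu mulr_sumr; apply: eq_bigr => j _.
rewrite mulrCA [map_mx intr u _ _]mxE -[(u j ord0)%:~R]ratr_int uE.
rewrite (rmorphM (@ratr K)) /= ratr_int.
by rewrite [map_mx _ _ j c]mxE.
Qed.

(** Raising to a kernel vector u contributes the extra factor z^(bMu), whose exponent is zero. *)
Lemma one_parameter_torus_of (C : fieldType) (n d : nat) (M : 'M[int]_(n, d))
    (b : 'rV[int]_n) (p : 'rV[C]_d) (z : C) :
  torus_of C M p -> z != 0 ->
  torus_of C M (\row_j (p ord0 j * z ^ (b *m M) ord0 j)).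
Proof.
move=> [p0 pM] z0; split=> [j|u Mu]; first by rewrite mxE mulf_neq0 ?expfz_neq0.
rewrite -[RHS](pM u Mu) /tpow; under eq_bigr do rewrite mxE expfzMl exprz_exp.
rewrite big_split /= -exprz_sum //.
have := mulmxA b M u; rewrite Mu mulmx0 => /matrixP/(_ ord0 ord0).
by rewrite !mxE => <-; rewrite expr0z mulr1.
Qed.

Lemma tangent_row (C : numClosedFieldType) (n d : nat) (M : 'M[int]_(n.+1, d.+1))
    (p : 'rV[C]_d.+1) (F : {mpoly C[d.+1]}) (i : 'I_n.+1) :
  first_row_ones M -> torus_of C M p -> vanishes_on (torus_of C M) F ->
  \sum_j (mderiv j F).@[p ord0] * (p ord0 j * (M i j)%:~R) = 0.
Proof.
move=> M1 pM FM.
have param (b : 'rV[int]_n.+1) (a : 'I_d.+1 -> nat) :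
    (forall j, (b *m M) ord0 j = a j) ->
    \sum_j (mderiv j F).@[p ord0] * (p ord0 j * (a j)%:R) = 0.
  move=> ba; apply: deriv_one_parameter => z z0.
  rewrite -[RHS](FM _ (one_parameter_torus_of b pM z0)).
  by apply: meval_eq => j; rewrite mxE ba.
(* [deriv_one_parameter] wants natural exponents. Adding [N] times the row of ones makes row [i]
   nonnegative; the contribution of that multiple is subtracted at the end. *)
pose N := (\sum_j `|M i j|)%N.
have NE j : exists a : nat, N%:Z + M i j = a.
  have : 0 <= N%:Z + M i j.
    rewrite -lerBlDr sub0r (le_trans (ler_norm _)) // normrN -abszE lez_nat.
    by rewrite /N (bigD1 j) //= leq_addr.
  by case: (_ + _) => // a _; exists a.
have [a aE] := fin_all_exists NE.
have /param PN : forall j, ((N%:Z *: delta_mx 0 ord0 : 'rV_n.+1) *m M) ord0 j = N.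
  by move=> j; rewrite -scalemxAl -rowE !mxE M1 mulr1.
have /param PA : forall j,
    ((N%:Z *: delta_mx 0 ord0 + delta_mx 0 i : 'rV_n.+1) *m M) ord0 j = a j.
  by move=> j; rewrite mulmxDl -scalemxAl -!rowE !mxE M1 mulr1 aE.
rewrite -[RHS](subrr 0) -[X in _ = X - _]PA -[X in _ = _ - X]PN -sumrB.
apply: eq_bigr => j _.
by rewrite -!mulrBr !pmulrn -mulrzBr -aE addrAC subrr add0r.
Qed.

Lemma tangent_space_torus (C : numClosedFieldType) (n d : nat)
    (M : 'M[int]_(n.+1, d.+1)) (p : 'rV[C]_d.+1) :
  first_row_ones M -> torus_of C M p ->
  tangent_space (toric_variety C M) p =
  [set v | (v <= map_mx intr M *m diag_mx p)%MS].
Proof.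
move=> M1 pM; rewrite /toric_variety torus_ofE //.
apply/seteqP; split=> v /=; last first.
  case/submxP => b -> e F Fe /= FM.
  have FT : vanishes_on (torus_of C M) F.
    by move=> x /sub_zariski_closure/FM.
  transitivity (\sum_i b ord0 i *
      \sum_j (mderiv j F).@[p ord0] * (p ord0 j * (M i j)%:~R)); last first.
    by rewrite big1 // => i _; rewrite tangent_row ?mulr0.
  under [RHS]eq_bigr do rewrite mulr_sumr.
  rewrite exchange_big; apply: eq_bigr => j _; rewrite mxE mulr_sumr.
  apply: eq_bigr => i _; rewrite mul_mx_diag !mxE [RHS]mulrCA; congr (_ * (_ * _)).
  by rewrite mulrC.
move=> vT; have [p0 pker] := pM.
(* In the coordinates w_j = v_j / p_j, the derivative of the binomial of [u] along [v] is the
   product of w u with the common nonzero value at p of the two monomials. *)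
pose w := v *m diag_mx (\row_j (p ord0 j)^-1).
have -> : v = w *m diag_mx p.
  by apply/rowP => j; rewrite /w !mul_mx_diag !mxE mulrAC mulfK.
apply/submxMr/int_kernel_dual => u Mu.
have := vT _ _ (binomial_of_homog C M1 Mu) _.
set P := 'X_[posm u].@[p ord0].
have P0 : P != 0 by rewrite /P mevalX; apply/prodf_neq0 => j _; rewrite expf_neq0.
have PE : P = 'X_[posm (- u)].@[p ord0] by rewrite /P meval_posm // pker // mul1r.
have : vanishes_on (zariski_closure (torus_of C M)) (binomial_of C u).
  apply: vanishes_on_closure (binomial_of_homog C M1 Mu) _.
  by move=> y [y0 yM]; rewrite mevalB meval_posm // yM // mul1r subrr.
move=> van /(_ van) vu; apply/matrixP => i j; rewrite !ord1 [RHS]mxE.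
apply: (mulfI P0); rewrite mulr0 -[RHS]vu mxE mulr_sumr; apply: eq_bigr => l _.
rewrite [map_mx _ _ _ _]mxE /w mul_mx_diag !mxE -[in LHS]posmB.
apply: (mulIf (p0 l)); rewrite [RHS]mulrAC mderivB mevalB mulrBl !mderiv_monomial.
rewrite -PE -/P -mulrBl rmorphB /= -mulrA [_ / _ * _]mulrC -[X in P * X]mulrA.
by rewrite divfK // mulrCA mulrA.
Qed.

(** * Comparison of row spans and proof of the theorem *)

(** A factorization M = X M' over [K] transfers kernel vectors, and integers embed injectively in
    characteristic zero. *)
Lemma int_kerS (K : numFieldType) (n n' d : nat) (M : 'M[int]_(n, d))
    (M' : 'M[int]_(n', d)) (u : 'cV[int]_d) :
  (map_mx intr M <= (map_mx intr M' : 'M[K]_(n', d)))%MS ->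
  M' *m u = 0 -> M *m u = 0.
Proof.
have int0 q (N : 'M[int]_(q, d)) :
    map_mx intr N *m map_mx intr u = 0 :> 'M[K]_(q, 1) <-> N *m u = 0.
  rewrite -map_mxM; split=> [/matrixP e|->]; last exact: map_mx0.
  apply/matrixP => i j; have := e i j; rewrite mxE [RHS]mxE => /eqP.
  by rewrite intr_eq0 => /eqP ->; rewrite mxE.
case/submxP => X ME /int0 M'u; apply/int0.
by rewrite ME -mulmxA M'u mulmx0.
Qed.

Lemma Aosc_first_row_ones (m d k : nat) (A : 'M[int]_(m.+1, d.+1)) :
  first_row_ones A -> first_row_ones (Aosc k A).
Proof.
have row0 : ord0 = lshift (nhigh m k) (ord0 : 'I_m.+1) by exact: val_inj.
by move=> A1 j; rewrite /Aosc row0; case: ifP => _;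
  exact: etrans (col_mxEu _ _ _ _) (A1 j).
Qed.

Lemma Aosc_ker (m d k : nat) (A : 'M[int]_(m.+1, d.+1)) (u : 'cV[int]_d.+1) :
  Aosc k A *m u = 0 -> A *m u = 0.
Proof.
have colu q (N : 'M[int]_(q, d.+1)) : col_mx A N *m u = 0 -> A *m u = 0.
  by rewrite mul_col_mx => /(congr1 usubmx); rewrite col_mxKu linear0.
by rewrite /Aosc; case: ifP => _; exact: colu.
Qed.

(** Any two parameters of [p] give diagonal matrices proportional to [diag_mx p], so the span is the
    same for each of them. *)
Lemma osculating_space_torus (C : numClosedFieldType) (m d k : nat)
    (A : 'M[int]_(m.+1, d.+1)) (p : 'rV[C]_d.+1) :
  (0 < k)%N -> first_row_ones A -> torus_of C A p ->
  osculating_space k A p =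
  [set v | (v <= map_mx intr (Aosc k A) *m diag_mx p)%MS].
Proof.
move=> k0 A1; rewrite -torus_ofE // => -[t0 t0T [c0 c00 pE0]].
have oscE t c : in_torus t -> c != 0 -> p = c *: iota_map A t ->
    (osc_matrix k A t :=: map_mx intr (Aosc k A) *m diag_mx p)%MS.
  move=> tT cn0 ->; apply: eqmx_trans (osc_matrix_eqmx k0 A1 tT) _.
  by rewrite linearZ /= -scalemxAr; apply/eqmx_sym/eqmx_scale.
apply/seteqP; split=> v /=.
  by case=> t [tT [c cn0 pE]]; rewrite (oscE t c).
by exists t0; [split=> //; exists c0|rewrite (oscE t0 c0)].
Qed.

Theorem theorem2p6 (R : realType) (m d k : nat) (A : 'M[int]_(m.+1, d.+1))
    (k_ge1 : (1 <= k)%N)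
    (A_ones : first_row_ones A)
    (A_rank : int_rank A = m.+1) :
  (forall p : 'rV[Cplx R]_d.+1,
      toric_variety (Cplx R) A p -> (forall j, p ord0 j != 0) ->
      toric_interpolant k A (Aosc k A) p) /\
  (forall (mB : nat) (B : 'M[int]_(mB.+1, d.+1))
      (B_ones : first_row_ones B) (B_rank : int_rank B = mB.+1)
      (t : 'I_m -> Cplx R),
      in_torus t -> toric_interpolant k A B (iota_map A t) ->
      toric_variety (Cplx R) B = toric_variety (Cplx R) (Aosc k A)).
Proof.
have Ak_ones := Aosc_first_row_ones k A_ones.
have subA : torus_of (Cplx R) A `<=` torus_of (Cplx R) (Aosc k A).
  by apply: sub_torus_of => u; exact: Aosc_ker.
split=> [p pA p0|mB B B_ones _ t tT [_ AB tangent]].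
  have pT : torus_of (Cplx R) A p.
    by apply: closure_torus_point => //; rewrite -torus_ofE.
  split=> //; first by rewrite /toric_variety !torus_ofE //; exact: zariski_closureS.
  by rewrite tangent_space_torus ?osculating_space_torus //; exact: subA.
set p := iota_map A t in tangent.
have pA : torus_of (Cplx R) A p.
  by rewrite -torus_ofE //; exists t => //; exists 1; rewrite ?oner_eq0 ?scale1r.
have p0 := pA.1.
(* The inclusion of varieties only places [p] in the closure; its nonzero coordinates place it in
   the torus of X_B, where the tangent space is known. *)
have pB : torus_of (Cplx R) B p.
  apply: closure_torus_point => //; rewrite -torus_ofE //; apply: AB.
  by rewrite /toric_variety torus_ofE //; exact: sub_zariski_closure.
move: tangent; rewrite tangent_space_torus // osculating_space_torus // => spans.
have p_unit : diag_mx p \in unitmx.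
  by rewrite unitmxE det_diag unitfE; apply/prodf_neq0.
(* Inclusion of the sets of vectors is tested on the rows of the first matrix, after which the
   invertible diagonal factor is removed. *)
have cancel q q' (N : 'M_(q, _)) (N' : 'M_(q', _)) :
    [set v : 'rV_d.+1 | (v <= N *m diag_mx p)%MS] `<=`
      [set v : 'rV_d.+1 | (v <= N' *m diag_mx p)%MS] ->
    (N <= N')%MS.
  move=> sub; rewrite -(mulmxK p_unit N) -(mulmxK p_unit N') submxMr //.
  by apply/row_subP => i; exact: (sub (row i _) (row_sub i _)).
rewrite /toric_variety !torus_ofE //; congr zariski_closure.
by apply/seteqP; split; apply: sub_torus_of => u; apply/int_kerS/cancel; rewrite spans.
Qed.
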